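(* Let $q$ be a prime power and let $\mathcal{M}$ be a class of simple $GF(q)$-representable matroids that is closed under taking induced minors. Let $\widetilde{\mathcal{M}}$ be the class of matroids obtained by starting with matroids in $\mathcal{M}$ and applying a (possibly empty) sequence of operations each of which is a tipped $q$-coning or a tipless $q$-coning. Then $\widetilde{\mathcal{M}}$ is closed under taking induced minors.
   Context: All matroids are simple; every contraction is immediately followed by simplification. An induced minor of $M$ is a matroid obtained from $M$ by a sequence of restrictions to flats and contractions (each contraction followed by simplification). For a simple $GF(q)$-representable matroid $N$ (viewed as a restriction of a projective geometry over $GF(q)$), its (tipped) $q$-coning $A(N)$ is obtained by adding a coloop $p$ (the tip) to $N$ and then adding every point on each projective line between $p$ and a point of $N$; the tipless $q$-coning of $N$ is $A(N)\backslash p$. *)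

(* Defs.v *)
From mathcomp Require Import all_boot all_algebra.

Set Implicit Arguments.
Unset Strict Implicit.
Unset Printing Implicit Defensive.

Import GRing.Theory.

(* Finite matroids, axiomatised by their rank function. *)
Record matroid := Matroid {
  ground :> finType;
  rk : {set ground} -> nat;
  rk_le_card : forall X : {set ground}, rk X <= #|X|;
  rk_mono : forall X Y : {set ground}, X \subset Y -> rk X <= rk Y;
  rk_submod : forall X Y : {set ground},
    rk (X :|: Y) + rk (X :&: Y) <= rk X + rk Y
}.

Arguments rk {m} X.

Definition iso (M N : matroid) : Prop :=
  exists f : M -> N, bijective f /\ forall X : {set M}, rk (f @: X) = rk X.

Definition cl (M : matroid) (X : {set M}) : {set M} :=
  [set e | rk (e |: X) == rk X].

Definition flat (M : matroid) (X : {set M}) : bool := cl X == X.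

Definition loop (M : matroid) (e : M) : bool := rk [set e] == 0.

(* Reflexive on non-loops, so that its classes are the parallel classes. *)
Definition parallel (M : matroid) (e f : M) : bool :=
  [&& ~~ loop e, ~~ loop f & rk [set e; f] == 1].

Definition simple (M : matroid) : Prop :=
  (forall e : M, ~~ loop e) /\ (forall e f : M, parallel e f -> e = f).

Section Restriction.

Variables (M : matroid) (A : {set M}).
Implicit Types X Y : {set {x : M | x \in A}}.

Definition restr_rk X : nat := rk (val @: X).

Fact restr_le_card X : restr_rk X <= #|X|.
Proof. by apply: leq_trans (rk_le_card _) (leq_imset_card _ _). Qed.

Fact restr_mono X Y : X \subset Y -> restr_rk X <= restr_rk Y.
Proof. by move=> sXY; apply: rk_mono; apply: imsetS. Qed.

Fact restr_submod X Y :
  restr_rk (X :|: Y) + restr_rk (X :&: Y) <= restr_rk X + restr_rk Y.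
Proof.
rewrite /restr_rk imsetU imsetI; first exact: rk_submod.
by move=> x y _ _; apply: val_inj.
Qed.

Definition restr : matroid := Matroid restr_le_card restr_mono restr_submod.

End Restriction.

Section Contraction.

Variables (M : matroid) (C : {set M}).
Implicit Types X Y : {set {x : M | x \notin C}}.

Definition contract_rk X : nat :=
  rk (val @: X :|: C) - rk C.

Fact contract_le_card X : contract_rk X <= #|X|.
Proof.
rewrite leq_subLR addnC.
have /(leq_trans (leq_addr _ _)) := rk_submod (val @: X) C.
move/leq_trans; apply; rewrite leq_add2r.
by apply: leq_trans (rk_le_card _) (leq_imset_card _ _).
Qed.

Fact contract_mono X Y : X \subset Y -> contract_rk X <= contract_rk Y.
Proof. by move=> sXY; apply/leq_sub2r/rk_mono/setSU/imsetS. Qed.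

Fact contract_submod X Y :
  contract_rk (X :|: Y) + contract_rk (X :&: Y) <=
  contract_rk X + contract_rk Y.
Proof.
have le_rkC (Z : {set M}) : rk C <= rk (Z :|: C) by apply/rk_mono/subsetUr.
rewrite -(leq_add2r (rk C + rk C)) /contract_rk !(addnACA _ _ (rk C)) !subnK //.
rewrite imsetU imsetI; last by move=> x y _ _; apply: val_inj.
by rewrite setUUl setUIl; apply: rk_submod.
Qed.

Definition contract : matroid :=
  Matroid contract_le_card contract_mono contract_submod.

End Contraction.

(* The restrictions of M to such sets S are the simplifications of M:
   S contains no loop and exactly one element of each parallel class. *)
Definition simplification_set (M : matroid) (S : {set M}) : Prop :=
  (forall e, e \in S -> ~~ loop e) /\
  (forall e, ~~ loop e -> #|[set f in S | parallel e f]| = 1).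

Inductive induced_minor (M : matroid) : matroid -> Prop :=
| induced_minor_refl : induced_minor M M
| induced_minor_flat (N : matroid) (X : {set N}) :
    induced_minor M N -> flat X -> induced_minor M (restr X)
| induced_minor_contract (N : matroid) (C : {set N}) (S : {set contract C}) :
    induced_minor M N -> simplification_set S -> induced_minor M (restr S).

Definition iso_closed (K : matroid -> Prop) : Prop :=
  forall M N, K M -> iso M N -> K N.

Definition induced_minor_closed (K : matroid -> Prop) : Prop :=
  forall M N, K M -> induced_minor M N -> K N.

Definition representable (F : finFieldType) (M : matroid) : Prop :=
  exists (n : nat) (v : M -> 'rV[F]_n),
    forall X : {set M}, rk X = \rank (\sum_(x in X) <<v x>>)%MS.

Section ProjectiveGeometry.

Variables (F : finFieldType) (n : nat).

(* The one-dimensional subspaces of F^n, each given as the row space of a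
   matrix in the canonical form <<A>>; equal subspaces are equal points. *)
Definition point : finType :=
  {A : 'M[F]_n | (<<A>>%MS == A) && (\rank A == 1)}.

Implicit Types X Y : {set point}.

Definition pg_rk X : nat := \rank (\sum_(P in X) val P)%MS.

Fact pg_le_card X : pg_rk X <= #|X|.
Proof.
apply: leq_trans (mxrank_sum_leqif _) _; rewrite /= -sum1_card.
by apply: leq_sum => P _; have /andP[_ /eqP->] := valP P.
Qed.

Fact pg_mono X Y : X \subset Y -> pg_rk X <= pg_rk Y.
Proof.
move=> /subsetP sXY; apply/mxrankS/sumsmx_subP => P /sXY PY.
exact: (sumsmx_sup P).
Qed.

Fact pg_submod X Y : pg_rk (X :|: Y) + pg_rk (X :&: Y) <= pg_rk X + pg_rk Y.
Proof.
rewrite /pg_rk -[leqRHS]mxrank_sum_cap; apply: leq_add; apply: mxrankS.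
  apply/sumsmx_subP => P; rewrite inE => /orP[PX|PY].
    by apply: submx_trans (addsmxSl _ _); apply: (sumsmx_sup P).
  by apply: submx_trans (addsmxSr _ _); apply: (sumsmx_sup P).
apply/sumsmx_subP => P; rewrite inE => /andP[PX PY].
by rewrite sub_capmx !(sumsmx_sup P).
Qed.

(* PG(n - 1, q), where q = #|F| *)
Definition pg : matroid := Matroid pg_le_card pg_mono pg_submod.

End ProjectiveGeometry.

Definition tipped_cone (F : finFieldType) (n : nat)
    (S : {set pg F n}) (p : pg F n) : {set pg F n} :=
  p |: \bigcup_(x in S) cl [set p; x].

(* A coning of N depends on the way N is viewed as a restriction of a
   projective geometry (inequivalent representations may give non-isomorphic
   conings), so that coning is a relation.  The condition p \notin cl S says
   that p is a coloop of the restriction to p |: S. *)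
Definition tipped_coning (F : finFieldType) (N N' : matroid) : Prop :=
  exists (n : nat) (S : {set pg F n}) (p : pg F n),
    [/\ iso N (restr S), p \notin cl S & iso N' (restr (tipped_cone S p))].

Definition tipless_coning (F : finFieldType) (N N' : matroid) : Prop :=
  exists (n : nat) (S : {set pg F n}) (p : pg F n),
    [/\ iso N (restr S), p \notin cl S
      & iso N' (restr (tipped_cone S p :\ p))].

Inductive coning_closure (F : finFieldType) (K : matroid -> Prop) :
  matroid -> Prop :=
| coning_closure_base N : K N -> coning_closure F K N
| coning_closure_tipped N N' :
    coning_closure F K N -> tipped_coning F N N' -> coning_closure F K N'
| coning_closure_tipless N N' :
    coning_closure F K N -> tipless_coning F N N' -> coning_closure F K N'.

(* Main.v *)
Require Import Defs.
From mathcomp Require Import all_boot all_algebra.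

(* A tipped or tipless coning [N] of [M] is given by vectors [v x] of [M] and
   a tip [p] outside their span, the points of [N] being the lines of the
   vectors [v x + a p], and possibly that of [p]. Let [W] be the span of a
   flat of [N], or of a set contracted in [N]. If [p] lies in [W], then the
   flat is a coning of the flat [{x | v x in W}] of [M], and the simplified
   contraction is that of [M] by [{x | v x in W}]. If [p] does not lie in [W],
   choose a hyperplane containing [W] but not [p], and move each [v x] along
   its line through [p] into that hyperplane; this does not change the matroid
   [M] nor its coning. Now the flat is isomorphic to the flat [{x | v x in W}]
   of [M], and the simplified contraction is a coning of that of [M] by [{x |
   v x in W}]. The theorem follows by induction on the number of conings. *)

Section Coning.

Set Implicit Arguments.
Unset Strict Implicit.
Unset Printing Implicit Defensive.
Import GRing.Theory.
Local Open Scope ring_scope.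

Variable F : finFieldType.

(** * Lines spanned by row vectors, and separating functionals *)

Lemma eqmx_rV_scale n (u w : 'rV[F]_n) :
  u != 0 -> (u :=: w)%MS -> exists2 c, c != 0 & u = c *: w.
Proof.
move=> u0 uw; have /sub_rVP[c uc] : (u <= w)%MS by rewrite uw.
by exists c => //; apply: contraNneq u0 => c0; rewrite uc c0 scale0r.
Qed.

Lemma eqmx_rV_le n (u w : 'rV[F]_n) : u != 0 -> (u <= w)%MS -> (u :=: w)%MS.
Proof.
move=> u0 /sub_rVP[c uc]; rewrite uc; apply: eqmx_scale.
by apply: contraNneq u0 => c0; rewrite uc c0 scale0r.
Qed.

Lemma eqmx_rV_eq0 n (u w : 'rV[F]_n) : (u :=: w)%MS -> (u == 0) = (w == 0).
Proof. by move=> uw; rewrite -!mxrank_eq0 uw. Qed.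

(** The kernel of [cokermx U] is the row space of [U], so the image of [p] has a non-zero entry. The
    column producing that entry, scaled to give 1 at [p], is the functional. *)
Lemma sep_col n m (p : 'rV[F]_n) (U : 'M[F]_(m, n)) : ~~ (p <= U)%MS ->
  exists2 l : 'cV[F]_n, p *m l = 1%:M & U *m l = 0.
Proof.
rewrite submxE => /rV0Pn[j k0]; set k := (_ *m _) _ _ in k0.
exists (k^-1 *: col j (cokermx U)); last first.
  by rewrite -scalemxAr colE mulmxA mulmx_coker mul0mx scaler0.
rewrite -scalemxAr colE mulmxA -colE; apply/matrixP => a b.
by rewrite !ord1 ![LHS]mxE [X in _ * X]mxE mulVf // mxE.
Qed.

(** * Spans of families of vectors *)

Definition rspan (T : finType) n (v : T -> 'rV[F]_n) (X : {set T}) :=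
  (\sum_(x in X) <<v x>>)%MS.

Lemma rspan_sup (T : finType) n (v : T -> 'rV[F]_n) (X : {set T}) x :
  x \in X -> (v x <= rspan v X)%MS.
Proof. by move=> xX; apply: (sumsmx_sup x); rewrite ?genmxE. Qed.

Lemma rspan_subP (T : finType) n (v : T -> 'rV[F]_n) m (U : 'M[F]_(m, n))
    (X : {set T}) :
  reflect (forall x, x \in X -> (v x <= U)%MS) (rspan v X <= U)%MS.
Proof.
by apply: (iffP sumsmx_subP) => h x xX; move: (h x xX); rewrite genmxE.
Qed.

Lemma rspanMr (T : finType) n m (v : T -> 'rV[F]_n) (g : 'M[F]_(n, m))
    (X : {set T}) :
  (rspan v X *m g :=: rspan (fun x => v x *m g) X)%MS.
Proof.
apply: eqmx_trans (sumsmxMr_gen _ _ _) _; apply: eqmx_sums => x _.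
by apply/eqmxP; rewrite !genmxE !(eqmxMr g (genmxE (v x))) !submx_refl.
Qed.

Lemma rspan_imset (S T : finType) n (f : S -> T) (v : T -> 'rV[F]_n)
    (X : {set S}) :
  (rspan v (f @: X) :=: rspan (v \o f) X)%MS.
Proof.
apply/eqmxP/andP; split; apply/rspan_subP => x.
  by case/imsetP => y yX ->; apply: (@rspan_sup _ _ (v \o f)).
by move=> xX; apply: (rspan_sup v (imset_f f xX)).
Qed.

Lemma eq_rspan (T : finType) n (v w : T -> 'rV[F]_n) (X : {set T}) :
  (forall x, x \in X -> (v x :=: w x)%MS) -> (rspan v X :=: rspan w X)%MS.
Proof. by move=> vw; apply: eqmx_sums => x /vw xy;
  apply/eqmxP; rewrite !genmxE !xy submx_refl. Qed.

Lemma rspanU (T : finType) n (v : T -> 'rV[F]_n) (X Y : {set T}) :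
  (rspan v (X :|: Y) :=: rspan v X + rspan v Y)%MS.
Proof.
apply/eqmxP/andP; split.
  apply/rspan_subP => x /setUP[] xX.
    exact: submx_trans (rspan_sup _ xX) (addsmxSl _ _).
  exact: submx_trans (rspan_sup _ xX) (addsmxSr _ _).
by rewrite addsmx_sub; apply/andP; split; apply/rspan_subP => x xX;
  apply: rspan_sup; rewrite inE xX ?orbT.
Qed.

Lemma rspan1 (T : finType) n (v : T -> 'rV[F]_n) x :
  (rspan v [set x] :=: v x)%MS.
Proof. by rewrite /rspan big_set1; apply: genmxE. Qed.

(** * Matroids represented by vectors *)

Definition rep (M : matroid) n (v : M -> 'rV[F]_n) :=
  forall X : {set M}, rk X = \rank (rspan v X).

Lemma rep_loop (M : matroid) n (v : M -> 'rV[F]_n) x :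
  rep v -> loop x = (v x == 0).
Proof. by move=> vP; rewrite /loop vP rspan1 mxrank_eq0. Qed.

Lemma rep_parallel (M : matroid) n (v : M -> 'rV[F]_n) x y : rep v ->
  parallel x y = (v x != 0) && (v x == v y)%MS.
Proof.
move=> vP; rewrite /parallel !(rep_loop _ vP) vP rspanU.
rewrite (adds_eqmx (rspan1 v x) (rspan1 v y)).
have [->|x0] /= := eqVneq (v x) 0; first by [].
have [y0|y0] /= := eqVneq (v y) 0.
  by apply/esym/negP => /eqmxP/eqmx_rV_eq0; rewrite y0 eqxx (negPf x0).
apply/eqP/idP => [r1|/andP[xy yx]].
  apply/eqmxP/(eqmx_trans (B := (v x + v y)%MS)); last apply: eqmx_sym.
    apply/eqmxP; rewrite -(geq_leqif (mxrank_leqif_eq _)) ?addsmxSl //.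
    by rewrite r1 rank_rV x0.
  apply/eqmxP; rewrite -(geq_leqif (mxrank_leqif_eq _)) ?addsmxSr //.
  by rewrite r1 rank_rV y0.
by rewrite (addsmx_idPl yx) rank_rV x0.
Qed.

Lemma rep_parallelP (M : matroid) n (v : M -> 'rV[F]_n) x y : rep v ->
  reflect (v x != 0 /\ (v x :=: v y)%MS) (parallel x y).
Proof.
by move=> vP; rewrite (rep_parallel _ _ vP); apply: (iffP andP) => -[? /eqmxP].
Qed.

Lemma rep_cl (M : matroid) n (v : M -> 'rV[F]_n) x (X : {set M}) : rep v ->
  (x \in cl X) = (v x <= rspan v X)%MS.
Proof.
move=> vP; rewrite inE !vP rspanU (adds_eqmx (rspan1 v x) (eqmx_refl _)).
apply/idP/idP => [|vx]; last by rewrite (addsmx_idPr vx).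
rewrite eq_sym (mxrank_leqif_sup (addsmxSr _ _)).
by apply: submx_trans (addsmxSl _ _).
Qed.

Lemma rep_simple (M : matroid) n (v : M -> 'rV[F]_n) : rep v ->
  simple M <-> (forall x, v x != 0) /\ (forall x y, (v x :=: v y)%MS -> x = y).
Proof.
move=> vP; split=> -[h1 h2]; split=> [x|x y].
- by rewrite -(rep_loop _ vP).
- by move=> vxy; apply: h2; apply/(rep_parallelP _ _ vP); rewrite -(rep_loop _ vP).
- by rewrite (rep_loop _ vP).
- by case/(rep_parallelP _ _ vP) => _ /h2.
Qed.

Lemma iso_rep (M N : matroid) (f : M -> N) n (v : N -> 'rV[F]_n) :
  (forall X : {set M}, rk (f @: X) = rk X) -> rep v -> rep (v \o f).
Proof. by move=> fP vP X; rewrite -fP vP rspan_imset. Qed.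

Lemma restr_rep (M : matroid) (A : {set M}) n (v : M -> 'rV[F]_n) :
  rep v -> rep (v \o val : restr A -> 'rV[F]_n).
Proof. by move=> vP X; rewrite -rspan_imset -vP. Qed.

Lemma iso_simple (M N : matroid) : iso M N -> simple N -> simple M.
Proof.
case=> f [/bij_inj fI fP] [h1 h2].
have lf x : loop (f x) = loop x by rewrite /loop -fP imset_set1.
split=> [x|x y]; first by rewrite -lf.
case/and3P=> lx ly xy; apply/fI/h2; rewrite /parallel !lf lx ly.
by rewrite -imset_set1 -imset_set1 -imsetU fP.
Qed.

(** Distinct elements of a simple matroid span distinct lines, so matching equal lines gives a
    bijection, and corresponding sets have the same span. *)
Lemma rep_iso (M N : matroid) n (v : M -> 'rV[F]_n) (w : N -> 'rV[F]_n) :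
    rep v -> rep w -> simple M -> simple N ->
    (forall x, exists y, (v x :=: w y)%MS) ->
    (forall y, exists x, (v x :=: w y)%MS) -> iso M N.
Proof.
move=> vP wP /(rep_simple vP)[_ vI] /(rep_simple wP)[_ wI] vw wv.
have fE x : exists y, (v x == w y)%MS by have [y /eqmxP] := vw x; exists y.
have gE y : exists x, (v x == w y)%MS by have [x /eqmxP] := wv y; exists x.
pose f x := xchoose (fE x); pose g y := xchoose (gE y).
have fP x : (v x :=: w (f x))%MS by apply/eqmxP/(xchooseP (fE x)).
have gP y : (v (g y) :=: w y)%MS by apply/eqmxP/(xchooseP (gE y)).
exists f; split=> [|X].
  exists g => [x|y]; first by apply: vI; apply: eqmx_trans (gP _) (eqmx_sym (fP _)).
  by apply: wI; apply: eqmx_trans (eqmx_sym (fP _)) (gP _).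
rewrite wP vP rspan_imset; apply/esym.
by have [] := @eq_rspan _ _ v (w \o f) X (fun x _ => fP x).
Qed.

Lemma restr_simple (M : matroid) (A : {set M}) : simple M -> simple (restr A).
Proof.
case=> h1 h2; split=> [x|x y].
  by rewrite /loop /= /restr_rk imset_set1; apply: h1.
rewrite /parallel /loop /= /restr_rk imsetU !imset_set1 => xy.
exact/val_inj/h2.
Qed.

(** * Linear images of representations, and contraction *)

Lemma rep_inj (M : matroid) n m (v : M -> 'rV[F]_n) (g : 'M[F]_(n, m)) :
    rep v ->
    (forall u : 'rV_n, (u <= rspan v setT)%MS -> u *m g = 0 -> u = 0) ->
  rep (fun x => v x *m g).
Proof.
move=> vP gI X; rewrite vP -(rspanMr v g X).
apply/esym/mxrank_injP; rewrite -submx0; apply/rV_subP => u.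
rewrite sub_capmx => /andP[uX /sub_kermxP ug]; rewrite (gI u) ?sub0mx //.
by apply: submx_trans uX _; apply/rspan_subP => x _; apply: rspan_sup; rewrite inE.
Qed.

(** This is rank-nullity for [g] on the span of [X] and [C]: by the hypotheses the kernel there is
    exactly the span of [C], which accounts for the subtracted rank of [C]. *)
Lemma rep_contract (M : matroid) (C : {set M}) n m (v : M -> 'rV[F]_n)
    (g : 'M[F]_(n, m)) :
    rep v -> (forall x, x \in C -> v x *m g = 0) ->
    (forall u : 'rV_n, (u <= rspan v setT)%MS -> u *m g = 0 ->
       (u <= rspan v C)%MS) ->
  rep (fun x : contract C => v (val x) *m g).
Proof.
move=> vP gC gI X; rewrite /= /contract_rk !vP; set A := _ :|: C.
have -> : \rank (rspan (fun x : contract C => v (val x) *m g) X)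
        = \rank (rspan v A *m g).
  rewrite (rspanMr v g A) rspanU.
  have /eqP s0 : (rspan (fun x => v x *m g) C == 0).
    by rewrite -submx0; apply/rspan_subP => x /gC ->; rewrite sub0mx.
  rewrite s0 addsmx0 //; apply/esym.
  by rewrite (rspan_imset val (fun x => v x *m g) X).
rewrite -(mxrank_mul_ker (rspan v A) g) -[X in (_ - X)%N]/(\rank _).
suff -> : \rank (rspan v A :&: kermx g)%MS = \rank (rspan v C) by rewrite addnK.
apply/eqmx_rank/andP; split.
  apply/rV_subP => u; rewrite sub_capmx => /andP[uX /sub_kermxP ug].
  apply: gI ug; apply: submx_trans uX _; apply/rspan_subP => x _.
  by apply: rspan_sup; rewrite inE.
rewrite sub_capmx; apply/andP; split; apply/rspan_subP => x xC.
  by apply: rspan_sup; rewrite inE xC orbT.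
by apply/sub_kermxP/gC.
Qed.

(** * Simplifications *)

Lemma simplification_exists (M : matroid) n (v : M -> 'rV[F]_n) : rep v ->
  exists S : {set M}, simplification_set S.
Proof.
(* The value of [pick] depends only on the predicate, so [r] takes one value on each parallel class.
   The default [x] is reached only at loops. *)
move=> vP; pose r (x : M) := odflt x [pick f | parallel x f].
have pxx (x : M) : ~~ loop x -> parallel x x.
  by rewrite (rep_loop _ vP) => x0; apply/(rep_parallelP _ _ vP).
have rP (x : M) : ~~ loop x -> parallel x (r x).
  by move=> /pxx xx; rewrite /r; case: pickP => [y //|/(_ x)]; rewrite xx.
have rE (x y : M) : parallel x y -> r x = r y.
  move=> xy; rewrite /r; have -> : [pick f | parallel x f] = [pick f | parallel y f].
    apply: eq_pick => z /=; rewrite !(rep_parallel _ _ vP).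
    case/(rep_parallelP _ _ vP): xy => x0 xy.
    by rewrite !xy (eqmx_rV_eq0 xy).
  case: pickP => // /(_ y); rewrite pxx //; by case/and3P: xy.
have lr (x : M) : ~~ loop x -> ~~ loop (r x) by move=> /rP /and3P[].
exists [set x | ~~ loop x & r x == x]; split=> [x|x lx].
  by rewrite inE => /andP[].
rewrite -(cards1 (r x)); apply: eq_card => y; rewrite !inE.
apply/andP/eqP => [[/andP[ly /eqP ry] /rE]|->]; first by rewrite ry.
by have xr := rP _ lx; rewrite lr //= -(rE _ _ xr) eqxx.
Qed.

(** Two parallel elements of [S] are both the unique member of [S] in their class. *)
Lemma simplification_simple (M : matroid) (S : {set M}) :
  simplification_set S -> simple (restr S).
Proof.
case=> h1 h2; split=> [x|x y].
  by rewrite /loop /= /restr_rk imset_set1; apply/h1/valP.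
rewrite /parallel /loop /= /restr_rk imsetU !imset_set1 => /and3P[lx ly xy].
have /eqP/cards1P[z zP] := h2 _ lx.
have Ez (t : restr S) : parallel (val x) (val t) -> val t = z.
  by move=> xt; apply/set1P; rewrite -zP inE xt (valP t).
apply: val_inj; rewrite (Ez y) ?/parallel ?lx ?ly // (Ez x) //.
by rewrite /parallel lx setUid; rewrite eqn_leq lt0n lx (leq_trans (rk_le_card _)) ?cards1.
Qed.

Lemma simplification_sup (M : matroid) (S : {set M}) n (v : M -> 'rV[F]_n) x :
  rep v -> simplification_set S -> v x != 0 ->
  exists y : restr S, (v x :=: v (val y))%MS.
Proof.
move=> vP [_ h2]; rewrite -(rep_loop _ vP) => /h2 c1.
have : (0 < #|[set f in S | parallel x f]|)%N by rewrite c1.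
case/card_gt0P => y; rewrite inE => /andP[yS /(rep_parallelP _ _ vP)[_ xy]].
by exists (Sub y yS).
Qed.

(** * Points of the projective geometry as vectors *)

Definition pt_vec n (P : pg F n) : 'rV[F]_n := nz_row (val P).

Lemma pt_vecE n (P : pg F n) : (pt_vec P :=: val P)%MS.
Proof.
have /andP[_ /eqP r1] := valP P.
apply/eqmxP; rewrite -(geq_leqif (mxrank_leqif_eq (nz_row_sub _))) r1.
by rewrite rank_rV lt0b nz_row_eq0 -mxrank_eq0 r1.
Qed.

Lemma pt_vec_neq0 n (P : pg F n) : pt_vec P != 0.
Proof. by have /andP[_ /eqP r1] := valP P; rewrite -mxrank_eq0 pt_vecE r1. Qed.

Lemma pt_vec_onto n (u : 'rV[F]_n) : u != 0 -> exists P, (pt_vec P :=: u)%MS.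
Proof.
move=> u0; have uP : (<<(<<u>> : 'M_n)>>%MS == <<u>>%MS) && (\rank <<u>>%MS == 1%N).
  by rewrite genmx_id eqxx genmxE rank_rV u0.
exists (exist _ <<u>>%MS uP).
by apply: eqmx_trans (pt_vecE _) _; rewrite SubK; apply: genmxE.
Qed.

Lemma pt_vec_inj n (P Q : pg F n) : (pt_vec P :=: pt_vec Q)%MS -> P = Q.
Proof.
move=> PQ; apply: val_inj.
have /andP[/eqP <- _] := valP P; have /andP[/eqP <- _] := valP Q.
apply/eq_genmx; apply: eqmx_trans (eqmx_sym (pt_vecE P)) _.
exact: eqmx_trans PQ (pt_vecE Q).
Qed.

Lemma pg_rep n : rep (M := pg F n) (@pt_vec n).
Proof.
move=> X; rewrite /= /pg_rk /rspan; apply/eqmx_rank/eqmxP/eqmx_sums => P _.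
by apply/eqmx_sym; apply: eqmx_trans (genmxE _) (pt_vecE P).
Qed.

Lemma pg_simple n : simple (pg F n).
Proof.
by apply/(rep_simple (@pg_rep n)); split; [apply: pt_vec_neq0|apply: pt_vec_inj].
Qed.

Lemma mem_line n (P Q R : pg F n) :
  (Q \in cl [set P; R]) = (pt_vec Q <= pt_vec P + pt_vec R)%MS.
Proof.
by rewrite (rep_cl _ _ (@pg_rep n)) rspanU (adds_eqmx (rspan1 _ P) (rspan1 _ R)).
Qed.

(** * Conings in terms of vectors *)

Definition cone (b : bool) n (S : {set pg F n}) (p : pg F n) :=
  if b then tipped_cone S p else tipped_cone S p :\ p.

(** Every line through the tip contains the tip, so the tip is split off: only there does [b]
    matter. *)
Lemma coneP (b : bool) n (S : {set pg F n}) (p Q : pg F n) :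
  reflect (b /\ Q = p \/
           Q != p /\ exists2 x, x \in S & (pt_vec Q <= pt_vec p + pt_vec x)%MS)
    (Q \in cone b S p).
Proof.
have -> : (Q \in cone b S p) = (Q == p) && b ||
    (Q != p) && (Q \in \bigcup_(x in S) cl [set p; x]).
  by rewrite /cone; case: b; rewrite !inE; case: eqP.
apply: (iffP orP) => -[] h; [left|right|left|right].
- by case/andP: h => /eqP.
- case/andP: h => -> /bigcupP[x xS]; rewrite mem_line => Qx.
  by split=> //; exists x.
- by case: h => -> ->; rewrite eqxx.
- case: h => -> [x xS Qx]; apply/bigcupP; exists x => //.
  by rewrite mem_line.
Qed.

Definition coning (b : bool) (N N' : matroid) : Prop :=
  exists (n : nat) (S : {set pg F n}) (p : pg F n),
    [/\ iso N (restr S), p \notin cl S & iso N' (restr (cone b S p))].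

(* Up to scalars, [w] lists the vectors of a coning, with tip [p], of the matroid
   with vectors [v]; the functional [l] witnesses that [p] is a coloop. *)
Record cone_rep (b : bool) (M N : matroid) n (v : M -> 'rV[F]_n)
    (w : N -> 'rV[F]_n) (p : 'rV[F]_n) (l : 'cV[F]_n) : Prop := ConeRep {
  cone_rep_base : rep v;
  cone_rep_cone : rep w;
  cone_simple_base : simple M;
  cone_simple_cone : simple N;
  cone_tip : p *m l = 1%:M;
  cone_hyper : forall x, v x *m l = 0;
  cone_sub : forall y, b /\ (w y :=: p)%MS \/
    exists x a, (w y :=: (v x + a *: p)%R)%MS;
  cone_sup : forall x a, exists y, (w y :=: (v x + a *: p)%R)%MS;
  cone_sup_tip : b -> exists y, (w y :=: p)%MS
}.

Lemma sub_mul0 n m k r (u : 'M[F]_(k, n)) (U : 'M[F]_(m, n)) (l : 'M[F]_(n, r)) :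
  (u <= U)%MS -> U *m l = 0 -> u *m l = 0.
Proof. by move=> /submxP[D ->] Ul; rewrite -mulmxA Ul mulmx0. Qed.

Lemma tip_mul0 n (p : 'rV[F]_n) (l : 'cV[F]_n) c :
  p *m l = 1%:M -> c *: p *m l = 0 -> c = 0.
Proof.
move=> pl; rewrite -scalemxAl pl => /matrixP/(_ 0 0).
by rewrite !mxE mulr1.
Qed.

(** If the sum were a multiple of [p], then so would be [u], and [l] vanishes on no non-zero
    multiple of [p]. *)
Lemma off_tip n (p u : 'rV[F]_n) (l : 'cV[F]_n) a :
  p *m l = 1%:M -> u *m l = 0 -> u != 0 ->
  u + a *: p != 0 /\ ~~ ((u + a *: p)%R <= p)%MS.
Proof.
move=> pl ul u0.
suff h : ~~ ((u + a *: p)%R <= p)%MS 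
  by split=> //; apply: contraNneq h => ->; apply: sub0mx.
apply/negP => /sub_rVP[c] /(canRL (addrK _)); rewrite -scalerBl.
set d := _ - _ => ud; case/eqP: u0; rewrite ud.
by rewrite (tip_mul0 (c := d) pl) ?scale0r // -ud.
Qed.

(** Choosing a spanning vector of each point turns the geometric coning into linear data; [l] comes
    from separating the tip from the span of [S]. *)
Lemma coning_cone_rep (b : bool) (M N : matroid) : coning b M N ->
  exists n (v : M -> 'rV[F]_n) w p l, cone_rep b (N := N) v w p l.
Proof.
case=> n [S] [P] [isoM]; rewrite (rep_cl _ _ (@pg_rep n)).
move=> /sep_col[l pl Sl] isoN.
have sM : simple M by apply: iso_simple isoM _; apply/restr_simple/pg_simple.
have sN : simple N by apply: iso_simple isoN _; apply/restr_simple/pg_simple.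
case: isoM => f [[f' fK f'K] fP]; case: isoN => g [[g' gK g'K] gP].
have vl x : pt_vec (val (f x)) *m l = 0.
  by apply: sub_mul0 Sl; apply: (rspan_sup _ (valP (f x))).
exists n, (fun x => pt_vec (val (f x))), (fun y => pt_vec (val (g y))).
exists (pt_vec P), l; split => //.
- exact: (iso_rep fP (restr_rep (@pg_rep n))).
- exact: (iso_rep gP (restr_rep (@pg_rep n))).
- move=> y; have /coneP[[bT ->]|[QP [x xS]]] := valP (g y); first by left.
  set Q := pt_vec (val (g y)).
  move=> /sub_addsmxP[[D E]] /= QE; right; exists (f' (Sub x xS)).
  move: QE; rewrite [D]mx11_scalar [E]mx11_scalar !mul_scalar_mx f'K SubK.
  set d := D 0 0; set e := E 0 0 => QE.
  (* With a zero coefficient of [x] the point would be the tip. Dividing by [e] normalises the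
     vector to coefficient 1 at [x]. *)
  have e0 : e != 0.
    apply: contraNneq QP => e0; apply/eqP/pt_vec_inj.
    apply: eqmx_rV_le (pt_vec_neq0 _) _.
    by rewrite -/Q QE e0 scale0r addr0 scalemx_sub.
  exists (d / e); rewrite QE.
  have -> : d *: pt_vec P + e *: pt_vec x = e *: (pt_vec x + (d / e) *: pt_vec P).
    by rewrite scalerDr scalerA mulrCA mulfV // mulr1 addrC.
  exact: eqmx_scale.
- move=> x a; have [u0 up] := off_tip a pl (vl x) (pt_vec_neq0 _).
  have [Q QE] := pt_vec_onto u0.
  have QT : Q \in cone b S P.
    apply/coneP; right; split; last first.
      exists (val (f x)); first exact: valP.
      rewrite QE; apply: addmx_sub; first exact: addsmxSr.
      by apply: scalemx_sub; apply: addsmxSl.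
    by apply: contraNneq up => QP; rewrite -QE QP.
  by exists (g' (Sub Q QT)); rewrite g'K SubK.
- move=> bT; have PT : P \in cone b S P by apply/coneP; left.
  by exists (g' (Sub P PT)); rewrite g'K SubK.
Qed.

(** This converse recognises a coning from its vectors alone, as is needed for minors. The points of
    the lines of [v] serve as [S]. *)
Lemma cone_rep_coning (b : bool) (M N : matroid) n (v : M -> 'rV[F]_n)
    (w : N -> 'rV[F]_n) p l :
  cone_rep b v w p l -> coning b M N.
Proof.
case=> vP wP sM sN pl vl low up tip.
have [v0 _] := iffLR (rep_simple vP) sM.
have p0 : p != 0.
  apply/eqP => p0; move: pl; rewrite p0 mul0mx => /matrixP/(_ 0 0)/eqP.
  by rewrite !mxE eq_sym oner_eq0.
have [P PE] := pt_vec_onto p0.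
pose S := [set Q : pg F n | [exists x, (pt_vec Q == v x)%MS]].
have SP Q : Q \in S -> exists x, (pt_vec Q :=: v x)%MS.
  by rewrite inE => /existsP[x /eqmxP]; exists x.
have PS x Q : (pt_vec Q :=: v x)%MS -> Q \in S.
  by move=> Qx; rewrite inE; apply/existsP; exists x; apply/eqmxP.
exists n, S, P; split.
- apply: (rep_iso vP (restr_rep (@pg_rep n))) => //.
  + exact/restr_simple/pg_simple.
  + move=> x; have [Q QE] := pt_vec_onto (v0 x).
    by exists (Sub Q (PS _ _ QE)); apply: eqmx_sym.
  + by move=> Q; have [x Qx] := SP _ (valP Q); exists x; apply: eqmx_sym.
- rewrite (rep_cl _ _ (@pg_rep n)) PE; apply/negP => pS.
  have pl0 : p *m l = 0.
    apply: sub_mul0 pS _; apply/sub_kermxP/rspan_subP => Q /SP[x ->].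
    exact/sub_kermxP.
  by have := oner_eq0 F; rewrite (tip_mul0 (c := 1) pl) ?eqxx // scale1r.
- apply: (rep_iso wP (restr_rep (@pg_rep n))) => //.
  + exact/restr_simple/pg_simple.
  + move=> y; case: (low y) => [[bT yp]|[x [a ya]]].
      have PT : P \in cone b S P by apply/coneP; left.
      by exists (Sub P PT); apply: eqmx_trans yp (eqmx_sym PE).
    have [u0 up'] := off_tip a pl (vl x) (v0 x).
    have [Q QE] := pt_vec_onto u0; have [R RE] := pt_vec_onto (v0 x).
    have QT : Q \in cone b S P.
      apply/coneP; right; split; last first.
        exists R; first exact: PS RE.
        rewrite QE; apply: addmx_sub; last first.
          by apply: scalemx_sub; rewrite -PE addsmxSl.
        by apply: submx_trans (addsmxSr _ _); rewrite RE.
      by apply: contraNneq up' => QP; rewrite -QE QP PE.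
    by exists (Sub Q QT); apply: eqmx_trans ya (eqmx_sym QE).
  + move=> Q; have /coneP[[bT QP]|[QP [R /SP[x Rx]]]] := valP Q.
      by have [y yp] := tip bT; exists y; rewrite /= QP;
        apply: eqmx_trans yp (eqmx_sym PE).
    rewrite (adds_eqmx PE Rx) => /sub_addsmxP[[D E]] /= QE.
    move: QE; rewrite [D]mx11_scalar [E]mx11_scalar !mul_scalar_mx.
    set d := D 0 0; set e := E 0 0 => QE.
    have e0 : e != 0.
      apply: contraNneq QP => e0; apply/eqP/pt_vec_inj.
      apply: eqmx_rV_le (pt_vec_neq0 _) _.
      by rewrite QE e0 scale0r addr0 PE scalemx_sub.
    have [y ye] := up x (d / e); exists y; rewrite /= QE.
    apply: eqmx_trans ye _.
    have -> : d *: p + e *: v x = e *: (v x + (d / e) *: p).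
      by rewrite scalerDr scalerA mulrCA mulfV // mulr1 addrC.
    exact/eqmx_sym/eqmx_scale.
Qed.

(** Projecting along [p] changes each [v x] by a multiple of [p], so the lines through the tip stay
    the same. The projection is injective on the span of [v], where [l] vanishes, because its kernel
    consists of multiples of [p]. *)
Lemma cone_rep_hyper (b : bool) (M N : matroid) n (v : M -> 'rV[F]_n)
    (w : N -> 'rV[F]_n) p l l' :
  cone_rep b v w p l -> p *m l' = 1%:M ->
  exists v' : M -> 'rV[F]_n, cone_rep b v' w p l'.
Proof.
case=> vP wP sM sN pl vl low up tip pl'.
pose g := 1%:M - l' *m p.
(* Right multiplication by [g] is the projection along [p] onto the kernel of [l']. *)
have gE u : u *m g = u - (u *m l') 0 0 *: p.
  by rewrite mulmxBr mulmx1 mulmxA {1}[u *m l']mx11_scalar mul_scalar_mx.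
exists (fun x => v x *m g); split => //.
- apply: rep_inj vP _ => u uv; rewrite gE.
  have ul : u *m l = 0.
    by apply: sub_mul0 uv _; apply/sub_kermxP/rspan_subP => x _; apply/sub_kermxP.
  move/eqP; rewrite subr_eq0 => /eqP; set c := _ 0 0 => uc.
  by rewrite uc (tip_mul0 (c := c) pl) ?scale0r // -uc.
- by move=> x; rewrite mulmxBr mulmx1 mulmxBl mulmxA -[_ *m p *m l']mulmxA pl' mulmx1 subrr.
- move=> y; case: (low y) => [|[x [a ya]]]; [by left|right].
  (* The new coefficient restores the multiple of [p] that the projection removed. *)
  by exists x, (a + (v x *m l') 0 0); rewrite gE scalerDl addrACA addNr addr0.
- move=> x a; have [y ya] := up x (a - (v x *m l') 0 0).
  by exists y; rewrite gE addrAC -addrA -scalerBl.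
Qed.

(** * Flats and contractions of a coning *)

Lemma mem_flat (M : matroid) n (v : M -> 'rV[F]_n) (X : {set M}) x :
  rep v -> flat X -> (x \in X) = (v x <= rspan v X)%MS.
Proof. by move=> vP /eqP XE; rewrite -(rep_cl _ _ vP) XE. Qed.

Lemma flat_sub (M : matroid) n m (v : M -> 'rV[F]_n) (W : 'M[F]_(m, n)) :
  rep v -> flat [set x | (v x <= W)%MS].
Proof.
move=> vP; apply/eqP/setP => x; rewrite (rep_cl _ _ vP) inE.
apply/idP/idP => [xX|xW]; last by apply: rspan_sup; rewrite inE.
by apply: submx_trans xX _; apply/rspan_subP => y; rewrite inE.
Qed.

Lemma tip_sub n m (p u : 'rV[F]_n) a (W : 'M[F]_(m, n)) :
  (p <= W)%MS -> ((u + a *: p)%R <= W)%MS = (u <= W)%MS.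
Proof.
move=> pW; apply/idP/idP => [|uW]; last by rewrite addmx_sub ?scalemx_sub.
by move=> h; rewrite -(addrK (a *: p) u) addmx_sub // -scaleNr scalemx_sub.
Qed.

(** Up to a scalar, [l] reads off the coefficient of [p]; where it vanishes, the element is not the
    tip and its coefficient is zero. *)
Lemma cone_rep_eq_base (b : bool) (M N : matroid) n (v : M -> 'rV[F]_n)
    (w : N -> 'rV[F]_n) p l y :
  cone_rep b v w p l -> w y *m l = 0 -> exists x, (w y :=: v x)%MS.
Proof.
case=> vP wP sM sN pl vl low up tip yl.
have l0 (u : 'rV_n) : (w y :=: u)%MS -> u *m l = 0.
  by move=> yu; apply: sub_mul0 yl; rewrite yu.
case: (low y) => [[_ /l0]|[x [a ya]]].
  by rewrite -[p]scale1r => /(tip_mul0 pl)/eqP; rewrite oner_eq0.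
have := l0 _ ya; rewrite mulmxDl vl add0r => /(tip_mul0 pl) a0.
by exists x; rewrite a0 scale0r addr0 in ya.
Qed.

Lemma cone_flat (b : bool) (M N : matroid) n (v : M -> 'rV[F]_n)
    (w : N -> 'rV[F]_n) p l (X : {set N}) :
  cone_rep b v w p l -> flat X ->
  exists2 A : {set M}, flat A &
    coning b (restr A) (restr X) \/ iso (restr A) (restr X).
Proof.
move=> + Xf; set W := rspan w X.
have [pW|/sep_col[l' pl' Wl']] := boolP (p <= W)%MS.
  case=> vP wP sM sN pl vl low up tip.
  (* With [p] in [W], for each [x] either all vectors [v x + a *: p] lie in [W] or none does, so the
     flat is a coning over [A] of the same kind. *)
  pose A := [set x | (v x <= W)%MS]; exists A; first exact: flat_sub.
  left; apply: (@cone_rep_coning b (restr A) (restr X) _ (v \o val) (w \o val) p l).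
  split; try exact: restr_rep; try exact: restr_simple; rewrite //=.
  - move=> y; case: (low (val y)) => [|[x [a ya]]]; [by left|right].
    have xA : x \in A.
      by rewrite inE -(tip_sub _ a pW) -ya -(mem_flat _ wP Xf); apply: valP.
    by exists (Sub x xA), a.
  - move=> x a; have [y ya] := up (val x) a.
    have yX : y \in X.
      by rewrite (mem_flat _ wP Xf) ya tip_sub //; have := valP x; rewrite inE.
    by exists (Sub y yX).
  - move=> /tip[y yp]; have yX : y \in X by rewrite (mem_flat _ wP Xf) yp.
    by exists (Sub y yX).
(* The base is moved into a hyperplane through [W], so that every element of the flat becomes a base
   point. *)
move=> cMN; have {cMN} [v' cMN] := cone_rep_hyper cMN pl'.
have eqb := cone_rep_eq_base cMN.
case: cMN => vP wP sM sN pl vl low up tip.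
pose A := [set x | (v' x <= W)%MS]; exists A; first exact: flat_sub.
right; apply: (rep_iso (restr_rep vP) (restr_rep wP)); try exact: restr_simple.
- move=> x; have [y] := up (val x) 0; rewrite scale0r addr0 => yx.
  have yX : y \in X by rewrite (mem_flat _ wP Xf) yx; have := valP x; rewrite inE.
  by exists (Sub y yX); apply: eqmx_sym.
- move=> y; have yW : (w (val y) <= W)%MS by apply: rspan_sup (valP y).
  have [x yx] := eqb _ (sub_mul0 yW Wl').
  have xA : x \in A by rewrite inE -yx.
  by exists (Sub x xA); apply: eqmx_sym.
Qed.

(** The map [g] has kernel [W], and it represents both the contraction of [N] by [C] and that of [M]
    by [C']. Their simplifications are thus compared line by line in one space. *)
Lemma cone_contract (b : bool) (M N : matroid) n (v : M -> 'rV[F]_n)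
    (w : N -> 'rV[F]_n) p l (C : {set N}) (S : {set contract C}) :
  cone_rep b v w p l -> simplification_set S ->
  exists (C' : {set M}) (S' : {set contract C'}), simplification_set S' /\
    ((exists b', coning b' (restr S') (restr S)) \/ iso (restr S') (restr S)).
Proof.
move=> + Ss; set W := rspan w C; pose g := cokermx W.
have gW m (u : 'M_(m, n)) : (u *m g == 0) = (u <= W)%MS by rewrite -submxE.
have wC y : y \in C -> (w y <= W)%MS by apply: rspan_sup.
have notC (T : matroid) (t : T -> 'rV[F]_n) (B : {set T}) y :
    (forall y, y \in B -> (t y <= W)%MS) -> t y *m g != 0 -> y \notin B.
  by move=> tB; rewrite gW; apply: contra; apply: tB.
have repw : rep w -> rep (fun y : contract C => w (val y) *m g).
  move=> wP; apply: rep_contract => // [y /wC|u _ /eqP]; last by rewrite gW.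
  by rewrite -gW => /eqP.
have [pW|pW] := boolP (p <= W)%MS.
  case=> vP wP sM sN pl vl low up tip.
  pose C' := [set x | (v x <= W)%MS]; exists C'.
  have vC x : x \in C' -> (v x <= W)%MS by rewrite inE.
  have gv : rep (fun x : contract C' => v (val x) *m g).
    apply: rep_contract => // [x /vC|u uv /eqP]; first by rewrite -gW => /eqP.
    rewrite gW => uW.
    (* Each contracted vector is the tip or [v x + a *: p] with [x] in [C']. Applying [l] to a
       vector in both [W] and the span of [v] then shows that its component along [p] is zero. *)
    have : (W <= rspan v C' + p)%MS.
      apply/rspan_subP => y yC; case: (low y) => [[_ ->]|[x [a ya]]].
        exact: addsmxSr.
      rewrite ya addmx_sub //; last by apply: scalemx_sub; apply: addsmxSr.
      apply: submx_trans (addsmxSl _ _); apply: rspan_sup.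
      by rewrite inE -(tip_sub _ a pW) -ya wC.
    move=> /(submx_trans uW) /sub_addsmxP[[D E]] /=.
    rewrite [E]mx11_scalar mul_scalar_mx; set e := E 0 0 => uE.
    have sl (B : {set M}) : rspan v B *m l = 0.
      by apply/sub_kermxP/rspan_subP => x _; apply/sub_kermxP.
    have := sub_mul0 uv (sl _); rewrite uE mulmxDl -mulmxA sl mulmx0 add0r.
    by move=> /(tip_mul0 pl) ->; rewrite scale0r addr0 submxMl.
  have [S' S's] := simplification_exists gv; exists S'; split=> //; right.
  apply: (rep_iso (restr_rep gv) (restr_rep (repw wP)));
    try exact: simplification_simple.
  - move=> x /=; have [y] := up (val (val x)) 0; rewrite scale0r addr0 => yx.
    have {}yx := eqmxMr g yx.
    have x0 : v (val (val x)) *m g != 0.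
      by rewrite -(rep_loop (val x) gv); case: S's => + _; apply; apply: valP.
    have y0 : w y *m g != 0 by rewrite (eqmx_rV_eq0 yx).
    have [z zy] := simplification_sup (x := exist _ y (notC _ _ _ _ wC y0) : contract C)
      (repw wP) Ss y0.
    by exists z; apply: eqmx_trans (eqmx_sym yx) zy.
  - move=> y /=.
    have y0 : w (val (val y)) *m g != 0.
      by rewrite -(rep_loop (val y) (repw wP)); case: Ss => + _; apply; apply: valP.
    case: (low (val (val y))) => [[_ yp]|[x [a ya]]].
      by case/negP: y0; rewrite gW yp.
    (* Since [g] kills the tip, all points [v x + a *: p] have the same image. *)
    have {}ya : (w (val (val y)) *m g :=: v x *m g)%MS.
      apply: eqmx_trans (eqmxMr g ya) _; move: pW; rewrite -gW => /eqP pg.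
      by rewrite mulmxDl -scalemxAl pg scaler0 addr0.
    have x0 : v x *m g != 0 by rewrite -(eqmx_rV_eq0 ya).
    have [z zx] := simplification_sup (x := exist _ x (notC _ _ _ _ vC x0) : contract C')
      gv S's x0.
    by exists z; apply: eqmx_sym; apply: eqmx_trans ya zx.
have [l' pl' Wl'] := sep_col pW.
move=> cMN; have {l cMN} [v' cMN] := cone_rep_hyper cMN pl'.
(* After the move every contracted element is a base point, so [W] is spanned by the vectors of
   [C']. *)
have eqb y (yC : y \in C) := cone_rep_eq_base cMN (sub_mul0 (wC y yC) Wl').
case: cMN => vP wP sM sN pl vl low up tip.
pose C' := [set x | (v' x <= W)%MS]; exists C'.
have vC x : x \in C' -> (v' x <= W)%MS by rewrite inE.
have gv : rep (fun x : contract C' => v' (val x) *m g).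
  apply: rep_contract => // [x /vC|u uv /eqP]; first by rewrite -gW => /eqP.
  rewrite gW => /submx_trans; apply; apply/rspan_subP => y yC.
  have [x yx] := eqb y yC; rewrite yx; apply: rspan_sup.
  by rewrite inE -yx wC.
have [S' S's] := simplification_exists gv; exists S'; split=> //; left.
(* If W != 0, a line through [p] and a contracted point of [M] has a third point,
   whose image under [g] is that of [p]: even a tipless coning acquires its tip. *)
exists (b || (W != 0)).
have pg0 : p *m g != 0 by rewrite gW.
have [v0 _] := iffLR (rep_simple vP) sM.
(* The image of the tip stays outside the span of the new base: otherwise [p] minus a vector of the
   kernel of [l'] would lie in [W], on which [l'] vanishes, against [p *m l' = 1]. *)
have pgS : ~~ (p *m g <= rspan (fun x : restr S' => v' (val (val x)) *m g) setT)%MS.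
  pose H := kermx l'.
  apply/negP => pS.
  have : (p *m g <= H *m g)%MS.
    apply: submx_trans pS _; apply/rspan_subP => x _; apply: submxMr.
    exact/sub_kermxP.
  case/submxP => D; rewrite mulmxA => /eqP; rewrite -subr_eq0 -mulmxBl gW.
  move=> /sub_mul0/(_ Wl'); rewrite mulmxBl -mulmxA mulmx_ker mulmx0 subr0 pl.
  by move/matrixP/(_ 0 0)/eqP; rewrite !mxE oner_eq0.
have [k pk Sk] := sep_col pgS.
have liftS y : w y *m g != 0 ->
    exists z : restr S, (w y *m g :=: w (val (val z)) *m g)%MS.
  move=> y0.
  have [z zy] := simplification_sup (x := exist _ y (notC _ _ _ _ wC y0) : contract C)
      (repw wP) Ss y0.
  by exists z.
apply: (@cone_rep_coning _ (restr S') (restr S) _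
         (fun x : restr S' => v' (val (val x)) *m g)
         (fun y : restr S => w (val (val y)) *m g) (p *m g) k).
have xk (x : restr S') : v' (val (val x)) *m g *m k = 0.
  by apply: sub_mul0 Sk; 
    apply: (rspan_sup (fun x : restr S' => v' (val (val x)) *m g)); rewrite inE.
split=> //; try exact: simplification_simple.
- exact: (restr_rep gv).
- exact: (restr_rep (repw wP)).
- move=> y /=.
  have y0 : w (val (val y)) *m g != 0.
    by rewrite -(rep_loop (val y) (repw wP)); case: Ss => + _; apply; apply: valP.
  case: (low (val (val y))) => [[bT yp]|[x [a ya]]].
    by left; split; [rewrite bT|apply: eqmxMr].
  have {}ya : (w (val (val y)) *m g :=: (v' x *m g + a *: (p *m g))%R)%MS.
    by rewrite scalemxAl -mulmxDl; apply: eqmxMr.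
  (* If [v' x] is contracted to zero, then [y] falls on the image of the tip; as [v' x] is a
     non-zero vector of [W], the new coning is tipped. *)
  have [x0|x0] := eqVneq (v' x *m g) 0.
    left; split.
      apply/orP; right; apply: contraTneq (v0 x) => W0.
      by move/eqP: x0; rewrite gW W0 submx0 => ->.
    move: ya; rewrite x0 add0r => ya; apply: eqmx_rV_le y0 _.
    by rewrite ya scalemx_sub.
  right.
  have [z zx] := simplification_sup (x := exist _ x (notC _ _ _ _ vC x0) : contract C')
      gv S's x0.
  (* The representative in [S'] spans the same line but may differ by a scalar [c], which rescales
     the coefficient of the tip. *)
  have [c c0 xc] := eqmx_rV_scale x0 zx.
  exists z, (a / c); apply: eqmx_trans ya _; rewrite /= xc.
  set u := _ *m g; set q := _ *m g.
  have -> : c *: u + a *: q = c *: (u + (a / c) *: q).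
    by rewrite scalerDr scalerA mulrCA mulfV // mulr1.
  exact: eqmx_scale.
- move=> x a; have [y ya] := up (val (val x)) a.
  have x0 : v' (val (val x)) *m g != 0.
    by rewrite -(rep_loop (val x) gv); case: S's => + _; apply; apply: valP.
  have [u0 _] := off_tip a pk (xk x) x0.
  have {}ya := eqmxMr g ya; rewrite mulmxDl -scalemxAl in ya.
  have [|z yz] := liftS y; first by rewrite (eqmx_rV_eq0 ya).
  by exists z; apply: eqmx_trans (eqmx_sym yz) ya.
- move=> bW.
  suff [y yp] : exists y, (w y *m g :=: p *m g)%MS.
    have [|z yz] := liftS y; first by rewrite (eqmx_rV_eq0 yp).
    by exists z; apply: eqmx_trans (eqmx_sym yz) yp.
  case/orP: bW => [/tip[y yp]|W0]; first by exists y; apply: eqmxMr.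
  have [c cC] : exists c, c \in C.
    apply/set0Pn; apply: contraNneq W0 => C0.
    by rewrite -submx0; apply/rspan_subP => y; rewrite C0 inE.
  have [x cx] := eqb c cC.
  have /eqP xg : v' x *m g == 0 by rewrite gW -cx wC.
  (* Any non-zero coefficient would do, since [g] kills the base part. *)
  have [y yx] := up x 1; exists y; apply: eqmx_trans (eqmxMr g yx) _.
  by rewrite mulmxDl xg add0r scale1r.
Qed.

(** * Closure under single minor operations *)

Lemma coning_closure_coning (b : bool) (K : matroid -> Prop) (N N' : matroid) :
  coning_closure F K N -> coning b N N' -> coning_closure F K N'.
Proof.
case: b => KN; first exact: coning_closure_tipped.
exact: coning_closure_tipless.
Qed.

Lemma iso_trans (M N P : matroid) : iso M N -> iso N P -> iso M P.
Proof.
case=> f [fB fP] [g [gB gP]]; exists (g \o f); split; first exact: bij_comp.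
by move=> X; rewrite imset_comp gP fP.
Qed.

Lemma iso_sym (M N : matroid) : iso M N -> iso N M.
Proof.
case=> f [[g fK gK] fP]; exists g; split; first by exists f.
by move=> X; rewrite -fP -imset_comp (eq_imset _ gK) imset_id.
Qed.

Lemma coning_closure_iso (K : matroid -> Prop) :
  iso_closed K -> iso_closed (coning_closure F K).
Proof.
move=> KI M N [{}M KM|{}M' {}M KM c|{}M' {}M KM c] MN.
- by apply: coning_closure_base; apply: KI MN.
- apply: coning_closure_tipped KM _; case: c => n [S [p [h1 h2 h3]]].
  by exists n, S, p; split=> //; apply: iso_trans (iso_sym MN) h3.
- apply: coning_closure_tipless KM _; case: c => n [S [p [h1 h2 h3]]].
  by exists n, S, p; split=> //; apply: iso_trans (iso_sym MN) h3.
Qed.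

(** Treating one minor operation at a time leaves an induction on the conings: the minor of a coning
    is isomorphic to a minor of its base, or is a coning of one. The base case is closure of [K]
    under a single operation. *)
Lemma coning_closure_step (K : matroid -> Prop) (N : matroid) :
    iso_closed K -> induced_minor_closed K -> coning_closure F K N ->
  (forall X : {set N}, flat X -> coning_closure F K (restr X)) /\
  (forall (C : {set N}) (S : {set contract C}), simplification_set S ->
     coning_closure F K (restr S)).
Proof.
move=> KI KM KN.
have step b (M M' : matroid) : coning_closure F K M -> coning b M M' ->
    (forall X : {set M}, flat X -> coning_closure F K (restr X)) /\
    (forall (C : {set M}) (S : {set contract C}), simplification_set S ->
     coning_closure F K (restr S)) ->
    (forall X : {set M'}, flat X -> coning_closure F K (restr X)) /\
    (forall (C : {set M'}) (S : {set contract C}), simplification_set S ->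
     coning_closure F K (restr S)).
  move=> KM1 /coning_cone_rep[n [v [w [p [l cMN]]]]] [IHf IHc].
  split=> [X /(cone_flat cMN)[A /IHf KA [c|i]]|C S /(cone_contract cMN)].
  - exact: coning_closure_coning KA c.
  - exact: coning_closure_iso KI _ _ KA i.
  - case=> C' [S' [/IHc KS [[b' c]|i]]].
      exact: coning_closure_coning KS c.
    exact: coning_closure_iso KI _ _ KS i.
elim: KN => {N} [N KN|M N KM1 IH c|M N KM1 IH c].
- have refl := induced_minor_refl N.
  split=> [X Xf|C S Ss]; apply: coning_closure_base; apply: KM KN _.
    exact: induced_minor_flat refl Xf.
  exact: induced_minor_contract refl Ss.
- exact: (step true _ _ KM1 c IH).
- exact: (step false _ _ KM1 c IH).
Qed.

End Coning.

Theorem theorem3p5 (q : nat) (F : finFieldType) (card_F : #|F| = q)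
    (K : matroid -> Prop) (K_iso : iso_closed K)
    (K_simple_rep : forall N : matroid, K N -> simple N /\ representable F N)
    (K_induced_minor : induced_minor_closed K) :
  induced_minor_closed (coning_closure F K).
Proof.
move=> M N KM MN.
elim: N / MN => // [N X _ KN Xf|N C S _ KN Ss];
  have [flt con] := coning_closure_step K_iso K_induced_minor KN.
  exact: flt.
exact: con.
Qed.
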